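(* For every $\varepsilon > 0$ there exist $\ell_0$ and $n_0$ such that for all $\ell \ge \ell_0$ and $n \ge n_0$ with $n\ell$ an integer, $i(n, n\ell) \ge \left(\frac12 - \varepsilon\right) n \ell^2 \log \ell$.
   Context: For a family $\mathcal{F}$ of subsets of $[n]$, $i(\mathcal{F})$ is the number of unordered pairs of distinct sets in $\mathcal{F}$ that are incomparable (neither contains the other). $i(n,m)$ is the minimum of $i(\mathcal{F})$ over all families $\mathcal{F}$ of $m$ subsets of $[n]$. $\log$ denotes the binary logarithm. *)

(* Defs.v *)
From mathcomp Require Import all_boot all_order all_algebra.
From mathcomp Require Import reals exp.
Set Implicit Arguments.
Unset Strict Implicit.
Unset Printing Implicit Defensive.
Import Order.TTheory GRing.Theory Num.Theory.

Definition incomparable (n : nat) (A B : {set 'I_n}) : bool :=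
  ~~ (A \subset B) && ~~ (B \subset A).

(* An unordered pair of distinct sets is represented by the two-element
   set [set A; B]. *)
Definition incomparable_pairs (n : nat) (F : {set {set 'I_n}}) :
    {set {set {set 'I_n}}} :=
  [set [set A; B] | A in F, B in F & (A != B) && incomparable A B].

Definition num_incomparable (n : nat) (F : {set {set 'I_n}}) : nat :=
  #|incomparable_pairs F|.

(* [num_incomparable] is monotone, so its value at the full power set is an
   upper bound for all its values and can serve as the initial value of the
   iterated minimum; it is the junk value when m > 2 ^ n, where no family of
   size m exists.  See [min_incomparable_le] and [min_incomparable_attained]. *)
Definition min_incomparable (n m : nat) : nat :=
  \big[minn/num_incomparable [set: {set 'I_n}]]_(F : {set {set 'I_n}}
      | #|F| == m) num_incomparable F.

Definition log2 (R : realType) (x : R) : R := (ln x / ln 2)%R.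

Lemma num_incomparable_mono (n : nat) (F G : {set {set 'I_n}}) :
  F \subset G -> num_incomparable F <= num_incomparable G.
Proof.
move=> /subsetP sFG; apply/subset_leq_card/subsetP => P /imset2P[A B AF].
rewrite inE => /andP[BF AB] ->; apply/imset2P; exists A B => //.
  exact: sFG.
by rewrite inE sFG.
Qed.

Lemma min_incomparable_le (n m : nat) (F : {set {set 'I_n}}) :
  #|F| = m -> min_incomparable n m <= num_incomparable F.
Proof.
move=> /eqP Fm; rewrite /min_incomparable -minEnat -leEnat.
exact: (bigmin_le_cond _ (@num_incomparable n) Fm).
Qed.

Lemma min_incomparable_attained (n m : nat) :
  m <= 2 ^ n ->
  exists2 F : {set {set 'I_n}},
    #|F| = m & num_incomparable F = min_incomparable n m.
Proof.
move=> le_m.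
have [F0 F0m] : exists F : {set {set 'I_n}}, #|F| = m.
  exists [set A in take m (enum [set: {set 'I_n}])].
  rewrite cardsE (card_uniqP _) ?take_uniq ?enum_uniq // size_takel //.
  by rewrite -cardE cardsT -cardsT -powersetT card_powerset cardsT card_ord.
have F0P : #|F0| == m by apply/eqP.
case: (@arg_minnP _ F0 (fun F => #|F| == m) (@num_incomparable n) F0P).
move=> F /eqP Fm minF; exists F => //.
apply/eqP; rewrite eqn_leq min_incomparable_le // andbT /min_incomparable.
elim/big_ind: _ => [|x y hx hy|G Gm].
- exact/num_incomparable_mono/subsetT.
- by rewrite leq_min hx hy.
- exact: minF.
Qed.

(* Main.v *)
(** The heart of the matter is that a family of k sets whose incomparability
    graph has maximum degree D >= D0(e), and which lies in an interval [X, Y], forces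
    |Y \ X| >= (1 - e) (k / D) log D. If k / D is bounded, the family contains a
    positive proportion of all possible chains of length r ~ k / D; by convexity it
    contains a positive proportion of all t-fold blow-ups of such chains, while an
    interval of dimension d contains at most (1 + r (2^t - 1))^d of these. Take
    logarithms and let t be large. If k / D is large, split the family into the
    members below and above a suitable set A and add up the two dimensions.

    For the whole cube this yields a vertex of degree at least
    (1 - e) (k / n) log (k / n) in every family of k sets with k / n large;
    deleting such vertices one at a time counts the incomparable pairs. *)

Require Import Defs.
From mathcomp Require Import all_boot all_order all_algebra.
From mathcomp Require Import reals exp.
From mathcomp Require Import zify ring lra.
Import Order.TTheory GRing.Theory Num.Theory.
Local Open Scope ring_scope.

(** * Averages over finite sets and convexity *)

(** Convexity: a power lies above its tangent at [m]. After multiplication by [x], the induction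
    leaves a nonnegative multiple of [(x - m) ^+ 2]. *)
Lemma tangent_le_exp (R : realFieldType) (x m : R) (p : nat) :
  0 <= x -> 0 <= m -> m ^+ p.+1 + p.+1%:R * m ^+ p * (x - m) <= x ^+ p.+1.
Proof.
move=> x0 m0; elim: p => [|p IH]; first by rewrite expr0 !expr1; lra.
rewrite [leRHS]exprS; apply: le_trans (ler_wpM2l x0 IH).
rewrite -subr_ge0.
have -> : x * (m ^+ p.+1 + p.+1%:R * m ^+ p * (x - m)) -
    (m ^+ p.+2 + p.+2%:R * m ^+ p.+1 * (x - m))
    = p.+1%:R * m ^+ p * (x - m) ^+ 2.
  by rewrite !exprS -(natr1 p.+1); ring.
by rewrite mulr_ge0 ?sqr_ge0 // mulr_ge0 ?exprn_ge0.
Qed.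

(** Equals 0 for empty [F], where Jensen's inequality fails for exponent 0. *)
Definition expect {R : realFieldType} {T : finType} (F : {set T}) (h : T -> R) : R :=
  (\sum_(x in F) h x) / #|F|%:R.

Lemma eq_expect (R : realFieldType) (T : finType) (F : {set T}) (h1 h2 : T -> R) :
  {in F, h1 =1 h2} -> expect F h1 = expect F h2.
Proof. by move=> e; congr (_ / _); apply: eq_bigr. Qed.

Lemma ler_expect (R : realFieldType) (T : finType) (F : {set T}) (h1 h2 : T -> R) :
  {in F, forall x, h1 x <= h2 x} -> expect F h1 <= expect F h2.
Proof. by move=> e; apply: ler_wpM2r; [rewrite invr_ge0|apply: ler_sum]. Qed.

Lemma expect_ge0 (R : realFieldType) (T : finType) (F : {set T}) (h : T -> R) :
  (forall x, 0 <= h x) -> 0 <= expect F h.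
Proof. by move=> e; rewrite divr_ge0 // sumr_ge0. Qed.

Lemma exchange_expect (R : realFieldType) (S T : finType) (E : {set S})
    (F : {set T}) (h : S -> T -> R) :
  expect E (fun x => expect F (h x)) = expect F (fun y => expect E (h^~ y)).
Proof. by rewrite /expect -!mulr_suml exchange_big /= mulrAC. Qed.

(** Average the tangent inequality at the mean: the linear term vanishes. *)
Lemma jensen_expect (R : realFieldType) (T : finType) (F : {set T}) (h : T -> R) (p : nat) :
  F != set0 -> (forall x, 0 <= h x) ->
  expect F h ^+ p <= expect F (fun x => h x ^+ p).
Proof.
move=> F0 h0.
have N0 : #|F|%:R != 0 :> R by rewrite pnatr_eq0 cards_eq0.
case: p => [|p]; first by rewrite /expect sumr_const expr0 divff.
set m := expect F h; have m0 : 0 <= m by apply: expect_ge0.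
have : expect F (fun x => m ^+ p.+1 + p.+1%:R * m ^+ p * (h x - m))
    <= expect F (fun x => h x ^+ p.+1).
  by apply: ler_expect => x _; apply: tangent_le_exp.
apply: le_trans; rewrite {1}/expect big_split -mulr_sumr sumrB !sumr_const /=.
have -> : \sum_(x in F) h x = m * #|F|%:R by rewrite divfK.
by rewrite -[m *+ _]mulr_natr subrr mulr0 addr0 -[_ ^+ _ *+ _]mulr_natr mulfK.
Qed.

(** * Means over sequences and over their blow-ups *)

Definition setpow {T : finType} (F : {set T}) (t : nat) : {set {ffun 'I_t -> T}} :=
  [set g in ffun_on (mem F)].

Lemma card_setpow (T : finType) (F : {set T}) (t : nat) : #|setpow F t| = (#|F| ^ t)%N.
Proof. by rewrite cardsE card_ffun_on card_ord. Qed.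

(** The entries of a uniformly random block are independent. *)
Lemma expect_prod (R : realFieldType) (T : finType) (F : {set T}) (t : nat) (h : T -> R) :
  expect (setpow F t) (fun g => \prod_j h (g j)) = expect F h ^+ t.
Proof.
rewrite /expect card_setpow natrX expr_div_n; congr (_ / _).
rewrite -[t in RHS]card_ord -prodr_const bigA_distr_big.
by apply: eq_bigl => g; rewrite inE.
Qed.

Fixpoint mean {R : realFieldType} {T : finType} (F : {set T}) (r : nat)
    (f : seq T -> R) : R :=
  if r is r'.+1 then expect F (fun x => mean F r' (fun s => f (x :: s)))
  else f [::].

(* The average of f over all choices of r blocks of t elements of F, where f is
   multiplied over the t ^ r sequences that take one element from each block. *)
Fixpoint blowup_mean {R : realFieldType} {T : finType} (F : {set T}) (t r : nat)
    (f : seq T -> R) : R :=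
  if r is r'.+1 then
    expect (setpow F t)
      (fun g => blowup_mean F t r' (fun s => \prod_j f (g j :: s)))
  else f [::].

Lemma eq_mean (R : realFieldType) (T : finType) (F : {set T}) (r : nat) (f1 f2 : seq T -> R) :
  f1 =1 f2 -> mean F r f1 = mean F r f2.
Proof. 
elim: r f1 f2 => [|r IH] f1 f2 e //=; apply: eq_expect => x _.
by apply: IH => s.
Qed.

Lemma eq_blowup_mean (R : realFieldType) (T : finType) (F : {set T}) (t r : nat)
    (f1 f2 : seq T -> R) :
  f1 =1 f2 -> blowup_mean F t r f1 = blowup_mean F t r f2.
Proof.
elim: r f1 f2 => [|r IH] f1 f2 e //=; apply: eq_expect => x _.
by apply: IH => s; apply: eq_bigr.
Qed.

Lemma mean_ge0 (R : realFieldType) (T : finType) (F : {set T}) (r : nat) (f : seq T -> R) :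
  (forall s, 0 <= f s) -> 0 <= mean F r f.
Proof. by elim: r f => [|r IH] f f0 //=; apply: expect_ge0 => x; apply: IH. Qed.

Lemma exchange_mean (R : realFieldType) (S T : finType) (E : {set S}) (F : {set T})
    (r : nat) (f : S -> seq T -> R) :
  expect E (fun y => mean F r (f y)) = mean F r (fun s => expect E (f^~ s)).
Proof.
elim: r f => [|r IH] f //=; rewrite exchange_expect.
by apply: eq_expect => x _; apply: (IH (fun y s => f y (x :: s))).
Qed.

Lemma jensen_mean (R : realFieldType) (T : finType) (F : {set T}) (r : nat)
    (f : seq T -> R) (p : nat) :
  F != set0 -> (forall s, 0 <= f s) ->
  mean F r f ^+ p <= mean F r (fun s => f s ^+ p).
Proof.
move=> F0; elim: r f => [|r IH] f f0 //=.
apply: le_trans (jensen_expect R T F _ p F0 _) _.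
  by move=> x; apply: mean_ge0.
by apply: ler_expect => x _; apply: IH.
Qed.

(** Two uses of Jensen per level. For a fixed tail, independence turns the block average into a
    [t]-th power, which Jensen compares with the power of the mean over tails; Jensen over blocks
    then moves the exponent [t ^ r] inside, where the induction hypothesis applies to each block. *)
Lemma mean_exp_le_blowup_mean (R : realFieldType) (T : finType) (F : {set T}) (t r : nat)
    (f : seq T -> R) :
  F != set0 -> (forall s, 0 <= f s) ->
  mean F r f ^+ (t ^ r) <= blowup_mean F t r f.
Proof.
move=> F0; elim: r f => [|r IH] f f0 //=.
have P0 : setpow F t != set0.
  by rewrite -cards_eq0 card_setpow expn_eq0 cards_eq0 (negbTE F0).
rewrite expnS exprM exchange_mean.
apply: le_trans (_ : expect (setpow F t)
  (fun g => mean F r (fun s => \prod_j f (g j :: s)) ^+ (t ^ r)) <= _); last first.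
  by apply: ler_expect => g _; apply: IH => s; apply: prodr_ge0.
apply: le_trans (jensen_expect R _ (setpow F t) _ (t ^ r) P0 _); last first.
  by move=> g; apply: mean_ge0 => s; apply: prodr_ge0.
rewrite exchange_mean.
rewrite [in leRHS](@eq_mean _ _ _ _ _ (fun s => expect F (fun x => f (x :: s)) ^+ t)); last first.
  by move=> s; exact: (expect_prod _ _ F t (fun x => f (x :: s))).
apply: lerXn2r; rewrite ?nnegrE.
- by apply: exprn_ge0; apply: mean_ge0 => s; apply: expect_ge0.
- by apply: mean_ge0 => s; apply: exprn_ge0; apply: expect_ge0.
by apply: jensen_mean => // s; apply: expect_ge0.
Qed.

(** * Chains and blown-up chains as means *)

(** Chains increase weakly, so members may repeat and the count is a mean over all sequences. *)
Fixpoint chains {n : nat} (F : {set {set 'I_n}}) (r : nat) (A : {set 'I_n}) : nat :=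
  if r is r'.+1 then \sum_(B in F | A \subset B) chains F r' B else 1.

(** Every member of a block is contained in every member of the next one. This constrains the next
    block only through the union of the current one, so the recursion carries just that union. *)
Fixpoint blown_chains {n : nat} (F : {set {set 'I_n}}) (t r : nat) (A : {set 'I_n}) : nat :=
  if r is r'.+1 then
    \sum_(g in setpow F t | [forall j, A \subset g j])
      blown_chains F t r' (\bigcup_j g j)
  else 1.

Lemma mulr_expect (R : realFieldType) (T : finType) (F : {set T}) (h : T -> R) (c : R) :
  c * expect F h = expect F (fun x => c * h x).
Proof. by rewrite /expect mulrA mulr_sumr. Qed.

Lemma mulr_mean (R : realFieldType) (T : finType) (F : {set T}) (r : nat)
    (f : seq T -> R) (c : R) :
  c * mean F r f = mean F r (fun s => c * f s).
Proof.
elim: r f => [|r IH] f //=; rewrite mulr_expect; apply: eq_expect => x _; exact: IH.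
Qed.

(** An indicator equals its [t]-th power for positive [t], so it passes through the products; a
    general scalar would be raised to the power [t ^ r]. *)
Lemma mulr_blowup_mean (R : realFieldType) (T : finType) (F : {set T}) (t r : nat)
    (f : seq T -> R) (b : bool) : (0 < t)%N ->
  b%:R * blowup_mean F t r f = blowup_mean F t r (fun s => b%:R * f s).
Proof.
move=> t0; elim: r f => [|r IH] f //=; rewrite mulr_expect; apply: eq_expect => x _.
rewrite IH; apply: eq_blowup_mean => s.
rewrite big_split /= prodr_const card_ord.
by case: b {IH}; rewrite ?expr1n // expr0n; case: t t0 x.
Qed.

Lemma mean_chains (R : realFieldType) (n : nat) (F : {set {set 'I_n}}) (r : nat) (A : {set 'I_n}) :
  F != set0 ->
  (chains F r A)%:R = #|F|%:R ^+ r *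
    mean F r (fun s => (path (fun B C : {set 'I_n} => B \subset C) A s)%:R) :> R.
Proof.
move=> F0; have N0 : #|F|%:R != 0 :> R by rewrite pnatr_eq0 cards_eq0.
elim: r A => [|r IH] A /=; first by rewrite mul1r.
rewrite /expect exprSr -mulrA [_ * (_ / _)]mulrC divfK // mulr_sumr natr_sum big_mkcondr.
apply: eq_bigr => B _ /=; case: ifP => AB; first by rewrite IH.
rewrite (@eq_mean _ _ _ _ _ (fun s => 0 * 0)) => [|s]; last by rewrite /= mul0r.
by rewrite -mulr_mean mul0r mulr0.
Qed.

Lemma prod_bool (R : realFieldType) (I : finType) (b : pred I) :
  \prod_i (b i)%:R = [forall i, b i]%:R :> R.
Proof.
case: forallP => [bT|/forallP]; first by rewrite big1 // => i _; rewrite bT.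
by rewrite negb_forall => /existsP[i /negbTE bi]; rewrite (bigD1 i) //= bi mul0r.
Qed.

(** Justifies carrying only the union. Some index [j] must exist to certify the part of the path
    inside [s], whence [0 < t]. *)
Lemma path_bigcup (n t : nat) (g : {ffun 'I_t -> {set 'I_n}}) (s : seq {set 'I_n}) :
  (0 < t)%N ->
  path (fun B C : {set 'I_n} => B \subset C) (\bigcup_j g j) s =
  [forall j, path (fun B C : {set 'I_n} => B \subset C) (g j) s].
Proof.
move=> t0; case: s => [|C s] /=; first by apply/esym/forallP.
apply/andP/forallP => [[/bigcupsP sub ->] j|sub]; first by rewrite sub.
split; first by apply/bigcupsP => j _; case/andP: (sub j).
by case/andP: (sub (Ordinal t0)).
Qed.

Lemma blowup_mean_chains (R : realFieldType) (n : nat) (F : {set {set 'I_n}}) (t r : nat)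
    (A : {set 'I_n}) : F != set0 -> (0 < t)%N ->
  (blown_chains F t r A)%:R = #|F|%:R ^+ (t * r) *
    blowup_mean F t r (fun s => (path (fun B C : {set 'I_n} => B \subset C) A s)%:R) :> R.
Proof.
move=> F0 t0; have N0 : #|F|%:R ^+ t != 0 :> R by rewrite expf_neq0 // pnatr_eq0 cards_eq0.
elim: r A => [|r IH] A /=; first by rewrite muln0 mul1r.
rewrite /expect card_setpow mulnS exprD natrX [RHS]mulrC mulrA divfK // mulr_suml natr_sum big_mkcondr.
apply: eq_bigr => g _ /=.
(* The product of the path indicators over the block splits into the condition that the block lies
   above [A], which leaves the mean, and the path indicator at the union. *)
rewrite (@eq_blowup_mean _ _ _ _ _ _ (fun s => [forall j, A \subset g j]%:R *
   (path (fun B C : {set 'I_n} => B \subset C) (\bigcup_j g j) s)%:R)); last first.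
  move=> s; rewrite path_bigcup // -natrM mulnb prod_bool; congr _%:R.
  congr nat_of_bool; apply/forallP/andP => [AP|[/forallP A1 /forallP A2] j].
    by split; apply/forallP => j; case/andP: (AP j).
  by rewrite /= A1 A2.
rewrite -mulr_blowup_mean // -mulrA [_ * _ ^+ _]mulrC -IH.
by case: ifP; rewrite ?mul1r ?mul0r.
Qed.

(** * Many chains in families of bounded degree *)

Definition incomparability_le {n : nat} (F : {set {set 'I_n}}) (D : nat) : Prop :=
  {in F, forall A, (#|[set B in F | incomparable A B]| <= D)%N}.

Lemma incomparability_leS (n : nat) (F G : {set {set 'I_n}}) (D : nat) :
  G \subset F -> incomparability_le F D -> incomparability_le G D.
Proof.
move=> /subsetP sGF dF A AG; apply: leq_trans (dF A (sGF A AG)).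
apply/subset_leq_card/subsetP => B; rewrite !inE => /andP[/sGF -> ->] //.
Qed.

(** Remove the members by increasing size. A smallest member has nothing else below it, so all but
    [D] of the current members contain it; removals only shrink the up-sets of the others. *)
Lemma sum_upsets_ge (n : nat) (F : {set {set 'I_n}}) (D : nat) (phi : nat -> nat) :
  {homo phi : i j / (i <= j)%N} -> incomparability_le F D ->
  (\sum_(i < #|F|) phi (i.+1 - D) <= \sum_(A in F) phi #|[set B in F | A \subset B]|)%N.
Proof.
move=> phi_mono; move Em: #|F| => m.
elim: m F Em => [|m IH] F Em dF; first by rewrite big_ord0.
have /set0Pn[A0 A0F] : F != set0 by rewrite -cards_eq0 Em.
case: (@arg_minnP _ A0 (mem F) (fun A : {set 'I_n} => #|A|) A0F) => A /= AF minA.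
rewrite (big_setD1 A) //= big_ord_recr /= addnC.
apply: leq_add.
  apply: phi_mono; rewrite leq_subLR -Em.
  apply: leq_trans (_ : #|[set B in F | incomparable A B] :|: [set B in F | A \subset B]| <= _)%N.
    apply/subset_leq_card/subsetP => B BF; rewrite !inE BF /= /incomparable.
    case: (boolP (A \subset B)) => //= AB; rewrite orbF; apply: contra AB => BA.
    have /eqP -> // : B == A by rewrite eqEcard BA minA.
  apply: leq_trans (leq_card_setU _ _) _; rewrite leq_add2r; exact: dF.
have mF : #|F :\ A| = m by move: (cardsD1 A F); rewrite AF Em => -[].
apply: leq_trans (IH _ mF (incomparability_leS _ _ _ _ (subsetDl _ _) dF)) _.
apply: leq_sum => B _; apply: phi_mono; apply/subset_leq_card/subsetP => C.
by rewrite !inE => /andP[/andP[_ ->] ->].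
Qed.

Lemma expSn_le (u r : nat) : (u.+1 ^ r.+1 <= u ^ r.+1 + r.+1 * u.+1 ^ r)%N.
Proof.
elim: r => [|r IH]; first by rewrite !expn1 expn0; lia.
rewrite expnS; apply: leq_trans (leq_mul (leqnn u.+1) IH) _.
have : (u ^ r.+1 <= u.+1 ^ r.+1)%N by rewrite leq_exp2r.
rewrite mulnDr mulnCA -expnS mulSn -expnS; lia.
Qed.

(** Telescopes the increments bounded in [expSn_le]: the discrete form of integrating a power. *)
Lemma sum_exp_ge (r m E : nat) :
  ((m - E) ^ r.+1 <= r.+1 * \sum_(i < m) (i.+1 - E) ^ r)%N.
Proof.
elim: m => [|m IH]; first by rewrite sub0n exp0n.
rewrite big_ord_recr /= mulnDr; apply: leq_trans (leq_add IH (leqnn _)).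
case: (leqP E m) => [Em|mE]; last first.
  by move: mE; rewrite -subn_eq0 => /eqP ->; rewrite exp0n.
rewrite subSn //; exact: expSn_le.
Qed.

(** Sum the induction hypothesis over the first element of the chain. By [sum_upsets_ge] each
    further element costs another [D], and summing the powers produces the factorial. *)
Lemma chains_ge (n : nat) (F : {set {set 'I_n}}) (D r : nat) (X : {set 'I_n}) :
  incomparability_le F D ->
  ((#|[set A in F | X \subset A]| - r.-1 * D) ^ r <= r`! * chains F r X)%N.
Proof.
move=> dF; elim: r X => [|r IH] X; first by rewrite expn0.
set G := [set A in F | X \subset A].
have dG : incomparability_le G D.
  by apply: incomparability_leS dF; apply/subsetP => A; rewrite inE => /andP[].
apply: leq_trans (sum_exp_ge _ _ _) _; rewrite factS -mulnA leq_mul2l /=.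
have phi_mono : {homo (fun u => (u - r.-1 * D) ^ r)%N : i j / (i <= j)%N}.
  by move=> i j ij; case: (r) => // k; rewrite leq_exp2r // leq_sub2r.
(* For [r = 0] the predecessor is truncated, but both exponents vanish. *)
have -> : (\sum_(i < #|G|) (i.+1 - r.+1.-1 * D) ^ r =
    \sum_(i < #|G|) ((i.+1 - D) - r.-1 * D) ^ r)%N.
  by apply: eq_bigr => i _; case: (r) => // k; rewrite -subnDA -mulSn.
apply: leq_trans (sum_upsets_ge _ _ _ _ phi_mono dG) _.
rewrite /= big_distrr /= (eq_bigl (fun B => (B \in F) && (X \subset B))) => [|B]; last first.
  by rewrite inE.
apply: leq_sum => B /andP[BF XB]; apply: leq_trans (IH B).
apply: phi_mono; apply/subset_leq_card/subsetP => C.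
by rewrite !inE => /andP[/andP[-> _] ->].
Qed.

(** * Few blown-up chains in an interval *)

Lemma sum_set_weight (t a : nat) :
  (\sum_(q : {set 'I_t}) (if q == set0 then a else 1) = a + (2 ^ t - 1))%N.
Proof.
rewrite (bigD1 set0) //= eqxx; congr addn.
rewrite (eq_bigr (fun=> 1%N)) => [|q /negbTE -> //].
rewrite sum1_card -[LHS]/(#|[pred q | q != set0]|).
have := cardC1 (set0 : {set 'I_t}).
rewrite -[#|{set 'I_t}|]cardsT -powersetT card_powerset cardsT card_ord subn1 => <-.
by apply: eq_card.
Qed.

(* The sets [set j | v \in g j], for v \in Y, determine g and can be chosen
   independently. *)
Lemma sum_families_le (n t a : nat) (X Y : {set 'I_n}) :
  (0 < t)%N -> X \subset Y ->
  (\sum_(g : {ffun 'I_t -> {set 'I_n}} | [forall j, (X \subset g j) && (g j \subset Y)])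
      a ^ #|Y :\: \bigcup_j g j| <= (a + (2 ^ t - 1)) ^ #|Y :\: X|)%N.
Proof.
move=> t0 XY.
pose tr (p : {ffun 'I_n -> {set 'I_t}}) : {ffun 'I_t -> {set 'I_n}} :=
  [ffun j => [set v | j \in p v]].
pose tr' (g : {ffun 'I_t -> {set 'I_n}}) : {ffun 'I_n -> {set 'I_t}} :=
  [ffun v => [set j | v \in g j]].
have tr_bij : bijective tr.
  by exists tr' => p; apply/ffunP => v; apply/setP => j; rewrite !(ffunE, inE).
(* Weight of one point: points of [X] lie in every [g j] and points outside [Y] in none; the others
   are free and earn a factor [a] exactly when the union misses them. *)
pose W (v : 'I_n) (q : {set 'I_t}) : nat :=
  if v \in X then nat_of_bool (q == setT) else if v \in Y then (if q == set0 then a else 1) else q == set0.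
rewrite (reindex tr (onW_bij _ tr_bij)) /=.
apply: leq_trans (_ : \sum_(p : {ffun 'I_n -> {set 'I_t}}) \prod_v W v (p v) <= _)%N.
  rewrite [leqRHS](bigID (fun p => [forall j, (X \subset tr p j) && (tr p j \subset Y)])) /=.
  apply: leq_trans (leq_addr _ _); apply: leq_sum => p /forallP pXY.
  rewrite -prod_nat_const big_mkcond /=; apply: eq_leq; apply: eq_bigr => v _.
  have vU : (v \in \bigcup_j tr p j) = (p v != set0).
    apply/bigcupP/set0Pn => [[j _]|[j]]; rewrite ?ffunE ?inE => jp; exists j => //.
    by rewrite ffunE inE.
  rewrite !inE vU negbK /W.
  have [vX|_] := boolP (v \in X).
    have -> : p v = setT.
      apply/setP => j; rewrite [RHS]inE; have /andP[/subsetP/(_ v vX)] := pXY j.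
      by rewrite ffunE inE.
    rewrite eqxx (subsetP XY) // andbT; case: eqP => // /setP/(_ (Ordinal t0)).
    by rewrite !inE.
  have [vY|/negbTE vY] := boolP (v \in Y); first by rewrite andbT.
  suff -> : p v = set0 by rewrite eqxx.
  apply/setP => j; rewrite [RHS]inE; apply/negbTE/negP => jp.
  have /andP[_ /subsetP/(_ v)] := pXY j; rewrite ffunE inE vY => /(_ jp) //.
(* The sum of products factors over the points; each point of [Y :\: X] contributes
   [a + (2 ^ t - 1)] and each other point 1. *)
rewrite -bigA_distr_bigA /= -prod_nat_const [leqRHS]big_mkcond /=.
apply: leq_prod => v _; rewrite !inE /W; have [vX|_] /= := boolP (v \in X).
  by rewrite (bigD1 setT) //= eqxx big1 // => q /negbTE ->.
have [vY|_] := boolP (v \in Y); first by rewrite sum_set_weight.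
by rewrite (bigD1 set0) //= eqxx big1 // => q /negbTE ->.
Qed.

(** Of the first block keep only that it lies between [X] and [Y], bound the continuations by
    induction, and apply [sum_families_le] with [a = 1 + r * (2 ^ t - 1)]. *)
Lemma blown_chains_le (n : nat) (F : {set {set 'I_n}}) (t r : nat) (X Y : {set 'I_n}) :
  (0 < t)%N -> {in F, forall A : {set 'I_n}, A \subset Y} -> X \subset Y ->
  (blown_chains F t r X <= (1 + r * (2 ^ t - 1)) ^ #|Y :\: X|)%N.
Proof.
move=> t0 FY; elim: r X => [|r IH] X XY; first by rewrite addn0 exp1n.
have -> : (1 + r.+1 * (2 ^ t - 1) = 1 + r * (2 ^ t - 1) + (2 ^ t - 1))%N.
  by rewrite mulSn addnA addnAC.
apply: leq_trans (sum_families_le _ _ _ _ _ t0 XY) => /=.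
rewrite [leqLHS]big_mkcond [leqRHS]big_mkcond /=; apply: leq_sum => g _.
case: ifP => // /andP[]; rewrite inE => /ffun_onP gF /forallP Xg.
have gY j : g j \subset Y by apply: FY; apply: gF.
rewrite ifT; first by apply: IH; apply/bigcupsP => j _; apply: gY.
by apply/forallP => j; rewrite Xg gY.
Qed.

(** * Dimension bound when the family size is at most a constant times [D] *)

(** Two estimates of [blown_chains F t r X]: by [chains_ge] the density of [r]-chains is at least
    [delta], so convexity bounds the count below; the interval bounds it above. *)
Lemma chain_density_exp_le (R : realFieldType) (n : nat) (F : {set {set 'I_n}})
    (X Y : {set 'I_n}) (D r t : nat) (delta : R) :
  F != set0 -> {in F, forall A : {set 'I_n}, (X \subset A) && (A \subset Y)} ->
  incomparability_le F D -> (0 < t)%N -> 0 <= delta ->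
  delta * (r`!)%:R * #|F|%:R ^+ r <= (#|F| - r.-1 * D)%N%:R ^+ r ->
  delta ^+ (t ^ r) * #|F|%:R ^+ (t * r) <= (1 + r * (2 ^ t - 1))%N%:R ^+ #|Y :\: X|.
Proof.
move=> F0 FXY dF t0 delta0 le_delta.
have N0 : 0 < #|F|%:R :> R by rewrite ltr0n card_gt0.
have XY : X \subset Y.
  by case/set0Pn: (F0) => A /FXY/andP[]; apply: subset_trans.
pose f (s : seq {set 'I_n}) : R := (path (fun B C : {set 'I_n} => B \subset C) X s)%:R.
apply: le_trans (_ : (blown_chains F t r X)%:R <= _); last first.
  rewrite -natrX ler_nat; apply: blown_chains_le => // A /FXY/andP[] //.
rewrite (blowup_mean_chains R) // mulrC ler_pM2l ?exprn_gt0 //.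
apply: le_trans (mean_exp_le_blowup_mean R _ F t r f F0 _); last by move=> s; apply: ler0n.
apply: lerXn2r; rewrite ?nnegrE //; first by apply: mean_ge0 => s; apply: ler0n.
have /eqP FX : [set A in F | X \subset A] == F.
  rewrite eqEsubset; apply/andP; split; apply/subsetP => A; rewrite inE; first by case/andP.
  by move=> AF; rewrite AF; case/andP: (FXY A AF).
have := chains_ge n F D r X dF; rewrite FX -(ler_nat R) natrX => /(le_trans le_delta).
rewrite natrM (mean_chains R) // -/f => le_mean.
have c0 : 0 < (r`!)%:R * #|F|%:R ^+ r :> R by apply: mulr_gt0; [rewrite ltr0n fact_gt0|exact: exprn_gt0].
by rewrite -(ler_pM2r c0) [leRHS]mulrC mulrA -[leRHS]mulrA.
Qed.

Lemma ln_large (R : realType) (T : R) :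
  exists N : nat, forall x : R, N%:R <= x -> 1 <= x /\ T <= ln x.
Proof.
exists (Num.trunc (Num.max 1 (sequences.expR T))).+1 => x Nx.
have := le_trans (ltW (truncnS_gt _)) Nx; rewrite ge_max => /andP[x1 Tx]; split=> //.
rewrite -[T]expRK ler_ln // posrE; first exact: expR_gt0.
exact: lt_le_trans x1.
Qed.

(** Collects three relative errors of size [h]: rounding in [Q], the density term [a], and the term
    [lK]. The conclusion rests on [(1 - h) ^+ 2 >= (1 + h) * (1 - 3 * h)]. *)
Lemma dim_arith (R : realFieldType) (h rho L Q T d a b lK lN : R) :
  0 < h < 1 / 3 -> 0 <= rho -> 0 <= L -> (1 - h) * rho <= Q -> 1 <= Q -> 1 <= T -> 0 <= d ->
  - a <= L * h -> L <= lN -> lK <= h * T * b -> a + T * Q * lN <= d * (lK + T * b) ->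
  (1 - 3 * h) * rho * L <= d * b.
Proof.
move=> /andP[h0 h1] rho0 L0 hQ Q1 T1 d0 aL LN lKb main.
have TL : h * L <= T * Q * (h * L).
  by apply: ler_peMl; [rewrite mulr_ge0 // ltW | rewrite mulr_ege1].
have TQL : T * Q * L <= T * Q * lN.
  by apply: ler_wpM2l => //; rewrite mulr_ge0; lra.
have dK : d * (lK + T * b) <= d * ((1 + h) * (T * b)).
  by apply: ler_wpM2l => //; lra.
have TQ : T * (Q * (1 - h) * L) <= T * ((1 + h) * (d * b)).
  have -> : T * (Q * (1 - h) * L) = T * Q * L - T * Q * (h * L) by ring.
  have -> : T * ((1 + h) * (d * b)) = d * ((1 + h) * (T * b)) by ring.
  move: aL TL TQL dK main; rewrite [L * h]mulrC; clear; lra.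
have {}TQ : Q * (1 - h) * L <= (1 + h) * (d * b).
  by rewrite -(@ler_pM2l _ T) //; lra.
have QL : (1 - h) * rho * ((1 - h) * L) <= Q * (1 - h) * L.
  rewrite -[Q * _ * _]mulrA; apply: ler_wpM2r => //.
  by rewrite mulr_ge0 //; lra.
rewrite -(@ler_pM2l _ (1 + h)); last by lra.
apply: le_trans TQ; apply: le_trans QL; rewrite -subr_ge0.
have -> : (1 - h) * rho * ((1 - h) * L) - (1 + h) * ((1 - 3 * h) * rho * L)
  = 4 * h ^+ 2 * (rho * L) by ring.
by apply: mulr_ge0; apply: mulr_ge0 => //; apply: sqr_ge0.
Qed.

Lemma dim_ge_bounded (R : realType) (e : R) (K : nat) : 0 < e < 1 -> (0 < K)%N ->
  exists D0 : nat, forall (D n : nat) (F : {set {set 'I_n}}) (X Y : {set 'I_n}),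
    (D0 <= D)%N -> incomparability_le F D ->
    {in F, forall A : {set 'I_n}, (X \subset A) && (A \subset Y)} ->
    (D <= #|F| <= K * D)%N ->
    (1 - e) * (#|F|%:R / D%:R) * ln D%:R <= #|Y :\: X|%:R * ln (2 : R).
Proof.
move=> /andP[e0 e1] K0; pose h : R := e / 3.
have h0 : 0 < h by rewrite divr_gt0.
have h1 : h < 1/3 by rewrite /h; lra.
have l2 : 0 < ln (2 : R) by rewrite ln_gt0 // ltr1n.
(* With this [t] the factor [K] in the base [K * 2 ^ t] is negligible after taking logarithms. *)
pose t := (Num.trunc (ln (K%:R : R) / (h * ln 2))).+1.
have lnK_le : ln K%:R <= h * t%:R * ln 2.
  rewrite mulrAC mulrC -ler_pdivrMr; last exact: mulr_gt0.
  exact/ltW/truncnS_gt.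
pose delta : R := h ^+ K / (K`!)%:R.
have delta0 : 0 < delta by rewrite divr_gt0 ?exprn_gt0 ?ltr0n ?fact_gt0.
have delta1 : delta <= 1.
  rewrite ler_pdivrMr ?ltr0n ?fact_gt0 // mul1r; apply: le_trans (_ : 1 <= _).
    by apply: exprn_ile1; lra.
  by rewrite ler1n fact_gt0.
(* [t] and [delta] depend only on [e] and [K], so a large [D] makes the logarithmic cost of the
   density at most [h * ln D]. *)
have [D0 D0P] := ln_large R (- ((t ^ K)%:R * ln delta) / h).
exists D0 => D n F X Y DD0 dF FXY /andP[DF FKD].
have [] := D0P D%:R; first by rewrite ler_nat.
move=> D1 lnD.

set N : R := #|F|%:R; set L := ln D%:R; set d : R := #|Y :\: X|%:R.
have Dpos : 0 < D%:R :> R by apply: lt_le_trans D1.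
have DN : D%:R <= N by rewrite ler_nat.
have Npos : 0 < N by apply: lt_le_trans DN.
have L0 : 0 <= L by apply: ln_ge0.
pose rho := N / D%:R.
have rho0 : 0 < rho by rewrite divr_gt0.
have rhoK : rho <= K%:R by rewrite ler_pdivrMr // -natrM ler_nat.
(* Chains will have [q.+1] elements: then [#|F| - q * D] is still at least [h * N], and [q.+1 <= K]
   makes [delta] a valid density. *)
pose q := Num.trunc ((1 - h) * rho).
have hrho0 : 0 <= (1 - h) * rho by rewrite mulr_ge0 // ?ltW //; lra.
have /andP[q_le q_gt] : q%:R <= (1 - h) * rho < q.+1%:R by apply: truncn_itv.
have qK : (q < K)%N.
  rewrite -(ltr_nat R); apply: le_lt_trans q_le _; apply: lt_le_trans rhoK.
  by rewrite gtr_pMl //; lra.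
have qD : q%:R * D%:R <= (1 - h) * N.
  by rewrite -ler_pdivlMr // -mulrA.
have qDF : (q * D <= #|F|)%N.
  by rewrite -(ler_nat R) natrM; apply: le_trans qD _; rewrite ger_pMl //; lra.
have base : delta * (q.+1`!)%:R * #|F|%:R ^+ q.+1 <= (#|F| - q.+1.-1 * D)%N%:R ^+ q.+1.
  apply: le_trans (_ : (h * N) ^+ q.+1 <= _); last first.
    apply: lerXn2r; rewrite ?nnegrE ?ler0n //; first by apply: mulr_ge0; apply: ltW.
    by rewrite natrB // natrM -/N; lra.
  rewrite exprMn ler_pM2r ?exprn_gt0 // /delta.
  apply: le_trans (_ : h ^+ K <= _); last by apply: ler_wiXn2l => //; lra.
  rewrite -mulrA ger_pMr ?exprn_gt0 // mulrC ler_pdivrMr ?ltr0n ?fact_gt0 // mul1r.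
  by rewrite ler_nat leq_fact.
have F0 : F != set0 by rewrite -card_gt0 -(ltr0n R).
have := chain_density_exp_le R n F X Y D q.+1 t delta F0 FXY dF isT (ltW delta0) base.
rewrite -/N => main.
have {}main : delta ^+ (t ^ K) * N ^+ (t * q.+1) <= (K * 2 ^ t)%N%:R ^+ #|Y :\: X|.
  apply: le_trans (_ : delta ^+ (t ^ q.+1) * N ^+ (t * q.+1) <= _).
    rewrite ler_pM2r ?exprn_gt0 //; apply: ler_wiXn2l => //; first exact: ltW.
    exact: leq_pexp2l.
  apply: le_trans main _; apply: lerXn2r; rewrite ?nnegrE ?ler0n // ler_nat.
  have t2 : (0 < 2 ^ t)%N by rewrite expn_gt0.
  apply: leq_trans (_ : q.+1 * 2 ^ t <= _)%N; last by rewrite leq_mul2r qK orbT.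
  by rewrite -[in leqRHS](subnK t2) mulnDr muln1 addnC leq_add2l.
have {}main : (t ^ K)%:R * ln delta + t%:R * q.+1%:R * ln N <= d * (ln K%:R + t%:R * ln 2).
  have K1 : 0 < K%:R :> R by rewrite ltr0n.
  have lhs0 : 0 < delta ^+ (t ^ K) * N ^+ (t * q.+1) by rewrite mulr_gt0 ?exprn_gt0.
  have rhs0 : 0 < (K * 2 ^ t)%N%:R :> R by rewrite ltr0n muln_gt0 K0 expn_gt0.
  have lnl : ln (delta ^+ (t ^ K) * N ^+ (t * q.+1)) =
      (t ^ K)%:R * ln delta + t%:R * q.+1%:R * ln N.
    by rewrite lnM ?posrE ?exprn_gt0 // !lnXn // -!(mulr_natl (ln _)) natrM.
  have lnr : ln ((K * 2 ^ t)%N%:R ^+ #|Y :\: X|) = d * (ln K%:R + t%:R * ln (2 : R)).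
    rewrite lnXn // natrM natrX lnM ?posrE ?exprn_gt0 //.
    by rewrite lnXn // -[LHS]mulr_natl -(mulr_natl (ln _)).
  by rewrite -lnl -lnr ler_ln // posrE exprn_gt0.
have lnN : L <= ln N by rewrite ler_ln ?posrE.
have t1 : 1 <= t%:R :> R by rewrite ler1n.
have q1 : 1 <= q.+1%:R :> R by rewrite ler1n.
have d0 : 0 <= d by rewrite ler0n.
move: lnD; rewrite ler_pdivrMr // => lnD.
have h3 : 0 < h < 1 / 3 by rewrite h0 h1.
have -> : e = 3 * h by rewrite /h mulrC divfK // pnatr_eq0.
exact: (dim_arith _ h _ _ _ _ _ _ _ _ _ h3 (ltW rho0) L0 (ltW q_gt) q1 t1 d0 lnD lnN lnK_le main).
Qed.

(** * Splitting a family; the dimension bound in general *)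

(** Cardinality orders [F] compatibly with inclusion; [S] is an initial segment and [A] the next
    member, ties being broken arbitrarily. *)
Lemma exists_by_size (n : nat) (F : {set {set 'I_n}}) (m : nat) : (m < #|F|)%N ->
  exists (S : {set {set 'I_n}}) (A : {set 'I_n}),
    [/\ #|S| = m, A \in F :\: S, S \subset F,
        {in S, forall B : {set 'I_n}, (#|B| <= #|A|)%N} &
        {in F :\: S, forall B : {set 'I_n}, (#|A| <= #|B|)%N}].
Proof.
have min_ex (G : {set {set 'I_n}}) : (0 < #|G|)%N ->
    exists2 A : {set 'I_n}, A \in G & {in G, forall B : {set 'I_n}, (#|A| <= #|B|)%N}.
  rewrite card_gt0 => /set0Pn[A0 A0G].
  by case: (@arg_minnP _ A0 (mem G) (fun A : {set 'I_n} => #|A|) A0G) => A AG minA; exists A.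
elim: m => [|m IH] mF.
  have [A AF minA] := min_ex F mF; exists set0, A; rewrite cards0 setD0 sub0set.
  by split => // B; rewrite inE.
have [S [A [Sm]]] := IH (ltnW mF).
rewrite inE => /andP[AS AF] SF maxS minS.
have S'F : A |: S \subset F by rewrite subUset sub1set AF.
have S'm : #|A |: S| = m.+1 by rewrite cardsU1 AS Sm.
have [|A' A'F minA'] := min_ex (F :\: (A |: S)).
  by rewrite cardsD (setIidPr S'F) S'm subn_gt0.
exists (A |: S), A'; split => // B; rewrite in_setU1 => /predU1P[->|BS].
  by apply: minS; move: A'F; rewrite !inE negb_or => /andP[/andP[_ ->] ->].
apply: leq_trans (maxS B BS) _.
by apply: minS; move: A'F; rewrite !inE negb_or => /andP[/andP[_ ->] ->].
Qed.

(** Take [A] in position [m.+1] by size. An earlier member is below [A] or incomparable to it, and a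
    member below [A] is earlier or [A] itself. *)
Lemma exists_split (n : nat) (F : {set {set 'I_n}}) (D m : nat) :
  incomparability_le F D -> (m < #|F|)%N ->
  exists2 A, A \in F &
    [/\ (m - D <= #|[set B in F | B \subset A]|)%N, (#|[set B in F | B \subset A]| <= m.+1)%N &
      (#|F| <= D + (#|[set B in F | B \subset A]| + #|[set B in F | A \proper B]|))%N].
Proof.
move=> dF /exists_by_size[S [A [Sm]]]; rewrite inE => /andP[AS AF] SF maxS minS.
have dA := dF A AF; exists A => //; split.
- rewrite leq_subLR -Sm.
  apply: leq_trans (_ : #|[set B in F | incomparable A B] :|: [set B in F | B \subset A]| <= _)%N.
    apply/subset_leq_card/subsetP => B BS; rewrite !inE (subsetP SF) //= /incomparable.
    case: (boolP (B \subset A)); rewrite ?orbT //= => BA; rewrite !andbT orbF.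
    apply: contra BA => AB; have /eqP -> // : A == B by rewrite eqEcard AB maxS.
  by apply: leq_trans (leq_card_setU _ _) _; rewrite leq_add2r.
- apply: leq_trans (_ : #|A |: S| <= _)%N; last by rewrite cardsU1 AS Sm.
  apply/subset_leq_card/subsetP => B; rewrite !inE => /andP[BF BA].
  case: (boolP (B \in S)); rewrite ?orbT // orbF => BS.
  by rewrite eqEcard BA minS // inE BS.
- apply: leq_trans (_ : #|[set B in F | incomparable A B] :|:
      ([set B in F | B \subset A] :|: [set B in F | A \proper B])| <= _)%N.
    apply/subset_leq_card/subsetP => B BF; rewrite !inE BF /= /incomparable properE.
    by case: (A \subset B); case: (B \subset A).
  apply: leq_trans (leq_card_setU _ _) (leq_add dA _); exact: leq_card_setU.
Qed.

(** Induction on the size of [F]: cut off a lower piece of bounded ratio, treat the rest by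
    induction, and add the dimensions. The at most [D] members lost at each cut are paid for by the
    slack between [e / 2] and [e]. *)
Lemma dim_ge (R : realType) (e : R) : 0 < e < 1 ->
  exists D0 : nat, forall (D n : nat) (F : {set {set 'I_n}}) (X Y : {set 'I_n}),
    (D0 <= D)%N -> incomparability_le F D ->
    {in F, forall A : {set 'I_n}, (X \subset A) && (A \subset Y)} ->
    (D <= #|F|)%N ->
    (1 - e) * (#|F|%:R / D%:R) * ln D%:R <= #|Y :\: X|%:R * ln (2 : R).
Proof.
move=> /andP[e0 e1]; have e2 : 0 < e / 2 < 1 by apply/andP; split; lra.
pose K := (Num.trunc (2 / e)).+1.
have K_gt : 2 <= e * K%:R by rewrite mulrC -ler_pdivrMr // ltW // truncnS_gt.
have [D0 D0P] := dim_ge_bounded R (e / 2) (K + 4) e2 (ltn_addr _ (ltn0Sn _)).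
exists (maxn 1 D0) => D n F X Y; rewrite geq_max => /andP[D1 D0D].
have D_gt0 : 0 < D%:R :> R by rewrite ltr0n.
have [L0 c0] : 0 <= ln D%:R :> R /\ 0 <= 1 - e / 2 by split; [rewrite ln_ge0 // ler1n|lra].
move Ek: #|F| => k; elim/ltn_ind: k F X Ek => k IH F X Ek dF FXY DF.
have [FK|FK] := leqP #|F| ((K + 4) * D).
  have bnd : (D <= #|F| <= (K + 4) * D)%N by rewrite Ek DF -Ek FK.
  apply: le_trans (D0P D n F X Y D0D dF FXY bnd); rewrite Ek.
  apply: ler_wpM2r => //; apply: ler_wpM2r; first by rewrite divr_ge0 // ltW.
  by move: e0; clear; lra.
(* Position [K.+1 * D] leaves at least [K * D] members in the lower piece; the threshold [K + 4]
   leaves at least [D] in the upper one. *)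
have mF : (K.+1 * D < #|F|)%N.
  by apply: leq_ltn_trans FK; rewrite leq_mul2r -addn1 leq_add2l orbT.
have [A AF [lb ub sum_ge]] := exists_split n F D (K.+1 * D) dF mF.
have /andP[XA AY] := FXY A AF.
set F1 := [set B in F | B \subset A] in lb ub sum_ge.
set F2 := [set B in F | A \proper B] in sum_ge.
have dF1 : incomparability_le F1 D.
  by apply: incomparability_leS dF; apply/subsetP => B; rewrite inE => /andP[].
have dF2 : incomparability_le F2 D.
  by apply: incomparability_leS dF; apply/subsetP => B; rewrite inE => /andP[].
have F1XA : {in F1, forall B : {set 'I_n}, (X \subset B) && (B \subset A)}.
  by move=> B; rewrite inE => /andP[/FXY/andP[-> _] ->].
have F2AY : {in F2, forall B : {set 'I_n}, (A \subset B) && (B \subset Y)}.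
  by move=> B; rewrite inE => /andP[/FXY/andP[_ ->] /proper_sub ->].
have F2k : (#|F2| < k)%N.
  rewrite -Ek; apply: proper_card; apply/properP; split.
    by apply/subsetP => B; rewrite inE => /andP[].
  by exists A; rewrite // inE properxx andbF.
have KF1 : (K * D <= #|F1|)%N by apply: leq_trans lb; rewrite mulSn addKn.
have F1_bnd : (D <= #|F1| <= (K + 4) * D)%N.
  apply/andP; split; first by apply: leq_trans KF1; rewrite leq_pmull.
  by apply: leq_trans ub _; rewrite mulSn mulnDl; move: D1; clear; lia.
have DF2 : (D <= #|F2|)%N.
  move: FK ub sum_ge; rewrite mulSn mulnDl; move: D1; clear; lia.
have dim1 := D0P D n F1 X A D0D dF1 F1XA F1_bnd.
have dim2 := IH _ F2k F2 A erefl dF2 F2AY DF2.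
have dimE : #|Y :\: X|%:R = #|A :\: X|%:R + #|Y :\: A|%:R :> R.
  rewrite -natrD; congr _%:R; rewrite -cardsUI.
  have -> : (A :\: X) :&: (Y :\: A) = set0.
    by apply/setP => v; rewrite !inE; case: (v \in A); rewrite ?andbF.
  rewrite cards0 addn0; congr #|pred_of_set _|; apply/setP => v; rewrite !inE.
  case: (boolP (v \in A)) => vA; first by rewrite (subsetP AY) // andbT orbF.
  rewrite andbF /=; case: (boolP (v \in X)) => // vX.
  by rewrite (subsetP XA) in vA.
have sumR : k%:R <= D%:R + (#|F1|%:R + #|F2|%:R) :> R by rewrite -!natrD ler_nat -Ek.
have KF1R : K%:R * D%:R <= #|F1|%:R :> R by rewrite -natrM ler_nat.
(* The lower piece has at least [K * D >= 2 * D / e] members, so [e / 2] of it covers the loss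
   [D]. *)
have F1_ge : (1 - e) * (#|F1|%:R + D%:R) <= (1 - e / 2) * #|F1|%:R.
  suff : (1 - e) * D%:R <= e / 2 * #|F1|%:R by clear; lra.
  apply: le_trans (_ : e / 2 * (K%:R * D%:R) <= _).
    by rewrite mulrA; apply: ler_wpM2r; [exact: ltW|move: e0 K_gt; clear; lra].
  by apply: ler_wpM2l => //; move: e0; clear; lra.
rewrite dimE [leRHS]mulrDl; apply: le_trans (lerD dim1 dim2).
rewrite -mulrDl; apply: ler_wpM2r => //; rewrite !mulrA -mulrDl.
apply: ler_wpM2r; first by rewrite invr_ge0 ltW.
apply: le_trans (_ : (1 - e) * (D%:R + (#|F1|%:R + #|F2|%:R)) <= _).
  by apply: ler_wpM2l sumR; move: e1; clear; lra.
by move: F1_ge; clear; lra.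
Qed.

(** * A member of high degree *)

(** Otherwise all degrees are at most [D], the integer part of the claimed bound [T]. The whole cube
    has dimension [n], so [dim_ge] with [e / 2] forces [D] to exceed [T], using [ln x <= ln D]. *)
Lemma exists_high_degree (R : realType) (e : R) : 0 < e < 1 ->
  exists N : nat, forall (n : nat) (F : {set {set 'I_n}}),
    (0 < n)%N -> N%:R <= #|F|%:R / n%:R :> R ->
    exists2 A, A \in F &
      (1 - e) * (#|F|%:R / n%:R) * log2 (#|F|%:R / n%:R) <=
        #|[set B in F | incomparable A B]|%:R.
Proof.
move=> /andP[e0 e1]; have e2 : 0 < e / 2 < 1 by apply/andP; split; lra.
have l2 : 0 < ln (2 : R) by rewrite ln_gt0 // ltr1n.
have [D0 D0P] := dim_ge R (e / 2) e2.
(* Ensures [log2 x >= 2 / (1 - e)], hence [2 * x <= T], so that even after rounding [D >= x]. *)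
have [N NP] := ln_large R (2 * ln 2 / (1 - e)).
exists (maxn N D0) => n F n0; set x := _ / _ => xN.
have n0R : 0 < n%:R :> R by rewrite ltr0n.
have FE : #|F|%:R = n%:R * x by rewrite /x mulrC divfK // gt_eqF.
clearbody x.
have [] := NP x; first by apply: le_trans xN; rewrite ler_nat leq_maxl.
move=> x1 lnx; have xD0 : D0%:R <= x by apply: le_trans xN; rewrite ler_nat leq_maxr.
have x0 : 0 < x by apply: lt_le_trans x1.
have e1' : 0 < 1 - e by rewrite subr_gt0.
have lnx0 : 0 < ln x by apply: lt_le_trans lnx; rewrite divr_gt0 ?mulr_gt0.
set T := (1 - e) * x * log2 x.
have T2x : 2 * x <= T.
  rewrite /T /log2 [leRHS]mulrA ler_pdivlMr //.
  move: lnx; rewrite ler_pdivrMr // => lnx.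
  by rewrite mulrAC [_ * x * ln x]mulrAC ler_pM2r // [(1 - e) * _]mulrC.
have T0 : 0 <= T by apply: le_trans T2x; rewrite mulr_ge0 // ltW.
have [/existsP[A /andP[AF TA]]|none] :=
    boolP [exists A, (A \in F) && (T <= #|[set B in F | incomparable A B]|%:R)].
  by exists A.
pose D := Num.trunc T.
have /andP[DT TD] : D%:R <= T < D.+1%:R by apply: truncn_itv.
have xD : x <= D%:R by rewrite -(natr1 D) in TD; lra.
have D_gt0 : 0 < D%:R :> R by apply: lt_le_trans xD.
have dF : incomparability_le F D.
  move=> A AF; rewrite leqNgt truncn_lt_nat //; apply: contra none => TA.
  by apply/existsP; exists A; rewrite AF ltW.
have D0D : (D0 <= D)%N by rewrite -(ler_nat R); apply: le_trans xD.
(* The cube has [2 ^ n] members, so [log2 x <= n] and [T <= n * x = #|F|]. *)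
have DF : (D <= #|F|)%N.
  rewrite -(ler_nat R); apply: le_trans DT _; rewrite FE /T [leLHS]mulrAC ler_pM2r //.
  apply: le_trans (_ : log2 x <= _).
    by apply: ler_piMl; [rewrite divr_ge0 ?ltW | move: e0; clear; lra].
  rewrite /log2 ler_pdivrMr //.
  have -> : n%:R * ln 2 = ln (2 ^+ n) :> R by rewrite lnXn ?ltr0n // mulr_natl.
  rewrite ler_ln ?posrE ?exprn_gt0 //.
  apply: le_trans (_ : #|F|%:R <= _).
    by rewrite FE ler_peMl ?ler1n // ltW.
  rewrite -natrX ler_nat; apply: leq_trans (max_card _) _.
  by rewrite -cardsT -powersetT card_powerset cardsT card_ord.
have F0Y : {in F, forall A : {set 'I_n}, (set0 \subset A) && (A \subset setT)}.
  by move=> A _; rewrite sub0set subsetT.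
have := D0P D n F set0 setT D0D dF F0Y DF.
rewrite setD0 cardsT card_ord FE => dim.
exfalso.
have lnD : ln x <= ln D%:R by rewrite ler_ln ?posrE.
have : (1 - e / 2) * (n%:R * x) * ln x <= n%:R * ln 2 * D%:R.
  rewrite -ler_pdivrMr //; apply: le_trans dim; rewrite -!mulrA.
  apply: ler_wpM2l; first by move: e0 e1; clear; lra.
  do 2 (apply: ler_wpM2l; first exact: ltW).
  by rewrite [leLHS]mulrC; apply: ler_wpM2l => //; rewrite invr_ge0 ltW.
apply/negP; rewrite -ltNge.
apply: le_lt_trans (_ : n%:R * ln 2 * T < _).
  by apply: ler_wpM2l => //; rewrite mulr_ge0 // ltW.
have -> : n%:R * ln 2 * T = (1 - e) * (n%:R * x) * ln x.
  by rewrite /T /log2; field; rewrite gt_eqF.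
by rewrite -!mulrA ltr_pM2r ?mulr_gt0 //; move: e0; clear; lra.
Qed.

(** * Counting incomparable pairs by deletion *)

Lemma incomparable_neq (n : nat) (A B : {set 'I_n}) : incomparable A B -> A != B.
Proof. by rewrite /incomparable => /andP[AB _]; apply: contraNneq AB => ->. Qed.

(** The pairs through [A] correspond to its incomparable partners and are disjoint from the pairs
    avoiding [A]. *)
Lemma num_incomparable_setD1 (n : nat) (F : {set {set 'I_n}}) (A : {set 'I_n}) : A \in F ->
  (#|[set B in F | incomparable A B]| + num_incomparable (F :\ A) <= num_incomparable F)%N.
Proof.
move=> AF; pose P := [set [set A; B] | B in [set B in F | incomparable A B]].
have <- : #|P| = #|[set B in F | incomparable A B]|.
  apply: card_in_imset => B C; rewrite !inE => /andP[_ /incomparable_neq AB] /andP[_ _].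
  move=> /setP/(_ B); rewrite !inE eqxx orbT eq_sym (negbTE AB) /= => /esym/eqP //.
have PD : [disjoint P & incomparable_pairs (F :\ A)].
  rewrite disjoint_subset; apply/subsetP => Q /imsetP[B _ ->]; rewrite inE; apply/negP.
  case/imset2P => C E; rewrite !inE => /andP[CA _] /andP[/andP[EA _] _] /setP/(_ A).
  by rewrite !inE eqxx (eq_sym A C) (eq_sym A E) (negbTE CA) (negbTE EA).
rewrite -[num_incomparable (F :\ A)]/(#|incomparable_pairs (F :\ A)|).
rewrite -cardsUI (disjoint_setI0 PD) cards0 addn0.
apply/subset_leq_card; rewrite subUset; apply/andP; split; last first.
  apply/subsetP => Q /imset2P[B C]; rewrite !inE => /andP[_ BF] /andP[/andP[_ CF] BC] ->.
  by apply/imset2P; exists B C => //; rewrite inE CF.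
apply/subsetP => Q /imsetP[B]; rewrite inE => /andP[BF AB] ->.
by apply/imset2P; exists A B => //; rewrite inE BF AB incomparable_neq.
Qed.

(** Delete members of high degree while at least [M] remain. Each deletion gains [c] times the
    current size, half a [c] more than the quadratic bound drops; below [M] that bound is not
    positive. *)
Lemma num_incomparable_ge (R : realFieldType) (n : nat) (F : {set {set 'I_n}}) (c M : R) :
  0 <= c -> 0 < M ->
  (forall G : {set {set 'I_n}}, G \subset F -> M <= #|G|%:R ->
     exists2 A, A \in G & c * #|G|%:R <= #|[set B in G | incomparable A B]|%:R) ->
  c * (#|F|%:R ^+ 2 - M ^+ 2) / 2 <= (num_incomparable F)%:R.
Proof.
move=> c0 M0; move Ek: #|F| => k; elim: k F Ek => [|k IH] F Ek deg.
  apply: le_trans (ler0n _ _); rewrite expr0n /= sub0r mulrN mulNr oppr_le0.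
  by rewrite divr_ge0 // mulr_ge0 // sqr_ge0.
have [kM|Mk] := ltP k.+1%:R M.
  apply: le_trans (ler0n _ _); rewrite pmulr_lle0 ?invr_gt0 // mulr_ge0_le0 //.
  by rewrite subr_le0; apply: lerXn2r; rewrite ?nnegrE ?ler0n // ltW.
have [|A AF] := deg F (subxx _); first by rewrite Ek.
rewrite Ek => degA.
have D1k : #|F :\ A| = k by move: (cardsD1 A F); rewrite AF Ek => -[].
have {}IH := IH _ D1k (fun G GF => deg G (subset_trans GF (subsetDl _ _))).
have := num_incomparable_setD1 n F A AF; rewrite -(ler_nat R) natrD; apply: le_trans.
apply: le_trans (lerD degA IH); rewrite -(natr1 k) -subr_ge0.
have -> : c * (k%:R + 1) + c * (k%:R ^+ 2 - M ^+ 2) / 2 - c * ((k%:R + 1) ^+ 2 - M ^+ 2) / 2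
  = c / 2 by field.
by rewrite divr_ge0.
Qed.

Theorem theorem1p6 (R : realType) (eps : R) (heps : 0 < eps) :
  exists (l0 : R) (n0 : nat), forall (l : R) (n m : nat),
    l0 <= l -> (n0 <= n)%N ->
    n%:R * l = m%:R ->
    (m <= 2 ^ n)%N ->
    (min_incomparable n m)%:R >= (1 / 2 - eps) * n%:R * l ^+ 2 * log2 l.
Proof.
pose e := Num.min eps (1 / 2).
have e0 : 0 < e by rewrite lt_min heps divr_gt0.
have e_eps : e <= eps by rewrite ge_min lexx.
have e2 : e <= 1 / 2 by rewrite ge_min lexx orbT.
have e1 : 0 < e < 1 by rewrite e0; move: e2; clear; lra.
clearbody e.
have [N NP] := exists_high_degree R e e1.
have [L LP] := ln_large R (- ln e / e).
(* The first bound gives [- ln e <= e * ln l], so [log2 (e * l)] is nearly [log2 l]; the second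
   makes [e * l] at least [N] and 1. *)
exists (Num.max L%:R (Num.max N%:R 1 / e)), 1%N => l n m.
rewrite ge_max => /andP[Ll]; rewrite ler_pdivrMr // [l * e]mulrC ge_max => /andP[Nel el1].
move=> n0 nlm m2n.
have [F Fm <-] := min_incomparable_attained m2n.
have [l1 lnl] := LP l Ll.
have l_gt0 : 0 < l by apply: lt_le_trans l1.
have el0 : 0 < e * l by rewrite mulr_gt0.
have n0R : 0 < n%:R :> R by rewrite ltr0n.
have l2 : 0 < ln (2 : R) by rewrite ln_gt0 // ltr1n.
have log0 : 0 <= log2 (e * l) by apply: divr_ge0; [apply: ln_ge0 | apply: ltW].
have loge : (1 - e) * log2 l <= log2 (e * l).
  rewrite /log2 [leLHS]mulrA; apply: ler_wpM2r; first by rewrite invr_ge0 ltW.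
  rewrite lnM ?posrE //; move: lnl; rewrite ler_pdivrMr //; clear; lra.
have logl0 : 0 <= log2 l by apply: divr_ge0; [apply: ln_ge0 | apply: ltW].
pose c := (1 - e) * log2 (e * l) / n%:R.
have e1' : 0 <= 1 - e by move: e2; clear; lra.
have c0 : 0 <= c by apply: divr_ge0 => //; exact: mulr_ge0.
have M0 : 0 < e * m%:R by rewrite -nlm; do 2 (apply: mulr_gt0 => //).
(* Deletion stops at [e * m] members; until then the ratio of size to [n] is at least [e * l], so
   one [c] serves throughout. *)
apply: le_trans (num_incomparable_ge R n F c (e * m%:R) c0 M0 _); last first.
  move=> G _ MG.
  have elG : e * l <= #|G|%:R / n%:R.
    by rewrite ler_pdivlMr // -mulrA [l * _]mulrC nlm.
  have [A AG degA] := NP n G n0 (le_trans Nel elG).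
  exists A => //; apply: le_trans degA.
  have -> : c * #|G|%:R = (1 - e) * (#|G|%:R / n%:R) * log2 (e * l).
    by rewrite /c; field; rewrite gt_eqF.
  apply: ler_wpM2l; first by rewrite mulr_ge0 // divr_ge0.
  apply: ler_wpM2r; first by rewrite invr_ge0 ltW.
  by rewrite ler_ln ?posrE //; apply: lt_le_trans elG.
rewrite Fm -nlm.
have -> : c * ((n%:R * l) ^+ 2 - (e * (n%:R * l)) ^+ 2) / 2 =
    (1 - e) * (1 - e ^+ 2) / 2 * (n%:R * l ^+ 2) * log2 (e * l).
  by rewrite /c; field; rewrite gt_eqF.
have nl0 : 0 <= n%:R * l ^+ 2 by rewrite mulr_ge0 // ?sqr_ge0 ?ltW.
rewrite -[_ * _ * l ^+ 2]mulrA.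
apply: le_trans (_ : (1 - e) * (1 - e ^+ 2) / 2 * (n%:R * l ^+ 2) * ((1 - e) * log2 l) <= _); last first.
  apply: ler_wpM2l loge; rewrite mulr_ge0 // divr_ge0 // mulr_ge0 //.
  by rewrite subr_ge0 exprn_ile1 // ltW //; case/andP: e1.
(* The accumulated constant [(1 - e) ^+ 2 * (1 - e ^+ 2) / 2] equals
   [1 / 2 - e + e ^+ 3 * (1 - e / 2)]. *)
rewrite -subr_ge0.
have -> : (1 - e) * (1 - e ^+ 2) / 2 * (n%:R * l ^+ 2) * ((1 - e) * log2 l) -
    (1 / 2 - eps) * (n%:R * l ^+ 2) * log2 l =
    (eps - e + e ^+ 3 * (1 - e / 2)) * (n%:R * l ^+ 2 * log2 l) by field.
apply: mulr_ge0; last exact: mulr_ge0.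
apply: addr_ge0; first by rewrite subr_ge0.
by apply: mulr_ge0; [rewrite exprn_ge0 // ltW | move: e2; clear; lra].
Qed.
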